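(* Let $(TM,\lambda)$ be an EAP-space. Assume that the canonical $d$-connection $D$ is of Berwald type. Then: (a) $P^a_{\mu b}=0$. (b) The $\lambda_{i\mu}$ are functions of the positional argument $x$ only. Consequently, so are the $g_{\mu\nu}$. (c) $\mathring C^\alpha_{\mu c}=0$. Consequently, $\gamma^\alpha_{\mu c}=0$. (d) The coefficients $\Gamma^\alpha_{\mu\nu}$ and $\mathring\Gamma^\alpha_{\mu\nu}$ are functions of the positional argument $x$ only and are given respectively by $$\Gamma^\alpha_{\mu\nu}(x)=(\lambda_i^\alpha\,\partial_\nu\lambda_{i\mu})(x),\qquad \mathring\Gamma^\alpha_{\mu\nu}(x)=\tfrac12\,g^{\alpha\epsilon}(\partial_\mu g_{\nu\epsilon}+\partial_\nu g_{\mu\epsilon}-\partial_\epsilon g_{\mu\nu})(x).$$ (e) $\Lambda^\alpha_{\mu\nu}$ and $\gamma^\alpha_{\mu\nu}$ are functions of the positional argument $x$ only. (f) $\gamma^a_{b\mu}=\mathring P^a_{\mu b}=0$. Consequently, $\Gamma^a_{b\mu}=\mathring\Gamma^a_{b\mu}$.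
   Context: Let $M$ be a smooth paracompact $n$-manifold, $TM$ its tangent bundle with induced local coordinates $(x^\mu,y^a)$, and $N=(N^a_\mu(x,y))$ a given nonlinear connection on $TM$. Greek indices denote horizontal and Latin indices vertical components; both run over $1,\dots,n$; repeated indices (including the mesh index $i$) are summed. Put $\partial_\mu=\partial/\partial x^\mu$, $\dot\partial_a=\partial/\partial y^a$, $\delta_\mu=\partial_\mu-N^a_\mu\dot\partial_a$ (adapted frame $(\delta_\mu,\dot\partial_a)$). A $d$-connection is a linear connection $D$ on $TM$ preserving by parallelism the horizontal and the vertical distribution; its coefficients $(\Gamma^\alpha_{\mu\nu},\Gamma^a_{b\nu},C^\alpha_{\mu c},C^a_{bc})$ are defined by $D_{\delta_\nu}\delta_\mu=\Gamma^\alpha_{\mu\nu}\delta_\alpha$, $D_{\delta_\nu}\dot\partial_b=\Gamma^a_{b\nu}\dot\partial_a$, $D_{\dot\partial_c}\delta_\mu=C^\alpha_{\mu c}\delta_\alpha$, $D_{\dot\partial_c}\dot\partial_b=C^a_{bc}\dot\partial_a$. It is of Berwald type if $\dot\partial_bN^a_\mu=\Gamma^a_{b\mu}$ and $C^\alpha_{\mu c}=0$. EAP-space $(TM,\lambda)$: $TM$ with $N$ and $n$ vector fields $\lambda_i=\lambda_i^\alpha\delta_\alpha+\lambda_i^a\dot\partial_a$ ($i=1,\dots,n$) defined globally on $TM$ with linearly independent horizontal parts and linearly independent vertical parts. $(\lambda_{i\alpha})$, $(\lambda_{ia})$ are the inverse matrices of $(\lambda_i^\alpha)$, $(\lambda_i^a)$.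 Metric: $g_{\alpha\beta}=\lambda_{i\alpha}\lambda_{i\beta}$, $g_{ab}=\lambda_{ia}\lambda_{ib}$, with inverses $g^{\alpha\beta}$, $g^{ab}$. Natural metric $d$-connection $\mathring D$: $\mathring\Gamma^\alpha_{\mu\nu}=\frac12g^{\alpha\epsilon}(\delta_\mu g_{\epsilon\nu}+\delta_\nu g_{\epsilon\mu}-\delta_\epsilon g_{\mu\nu})$, $\mathring\Gamma^a_{b\nu}=\dot\partial_bN^a_\nu+\frac12g^{ac}(\delta_\nu g_{bc}-g_{dc}\dot\partial_bN^d_\nu-g_{bd}\dot\partial_cN^d_\nu)$, $\mathring C^\alpha_{\mu c}=\frac12g^{\alpha\epsilon}\dot\partial_cg_{\mu\epsilon}$, $\mathring C^a_{bc}=\frac12g^{ad}(\dot\partial_bg_{dc}+\dot\partial_cg_{db}-\dot\partial_dg_{bc})$; $\mathring P^a_{\mu b}=\dot\partial_bN^a_\mu-\mathring\Gamma^a_{b\mu}$. Canonical $d$-connection $D$: $\Gamma^\alpha_{\mu\nu}=\lambda_i^\alpha\delta_\nu\lambda_{i\mu}$, $\Gamma^a_{b\nu}=\lambda_i^a\delta_\nu\lambda_{ib}$, $C^\alpha_{\mu c}=\lambda_i^\alpha\dot\partial_c\lambda_{i\mu}$, $C^a_{bc}=\lambda_i^a\dot\partial_c\lambda_{ib}$; $\Lambda^\alpha_{\mu\nu}=\Gamma^\alpha_{\mu\nu}-\Gamma^\alpha_{\nu\mu}$, $P^a_{\mu b}=\dot\partial_bN^a_\mu-\Gamma^a_{b\mu}$.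 Contortion components: $\gamma^\alpha_{\mu\nu}=\Gamma^\alpha_{\mu\nu}-\mathring\Gamma^\alpha_{\mu\nu}$, $\gamma^a_{b\mu}=\Gamma^a_{b\mu}-\mathring\Gamma^a_{b\mu}$, $\gamma^\alpha_{\mu c}=C^\alpha_{\mu c}-\mathring C^\alpha_{\mu c}$. *)

(* Defs.v *)
From HB Require Import structures.
From mathcomp Require Import all_boot all_order all_algebra.
From mathcomp Require Import all_classical all_reals all_analysis.

Set Implicit Arguments.
Unset Strict Implicit.
Unset Printing Implicit Defensive.

Import Order.TTheory GRing.Theory Num.Theory.
Import numFieldNormedType.Exports.
Local Open Scope classical_set_scope.
Local Open Scope ring_scope.

(* On an open set of a finite-dimensional space this is the usual notion of a *)
(* C^k map; quantifying over all directions v instead of over the vectors of a *)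
(* basis makes it independent of coordinates. *)
Fixpoint Ck_on (R : realType) (V W : normedModType R) (k : nat) (D : set V)
    (f : V -> W) : Prop :=
  (forall x, D x -> {for x, continuous f}) /\
  (if k is k'.+1 then
     forall v, (forall x, D x -> derivable f x v) /\ Ck_on k' D ('D_v f)
   else True).

Definition smooth_on (R : realType) (V W : normedModType R) (D : set V)
    (f : V -> W) : Prop := forall k, Ck_on k D f.

Definition paracompact (M : topologicalType) : Prop :=
  forall F : set (set M),
    (forall U, F U -> open U) -> (forall m, exists2 U, F U & U m) ->
    exists G : set (set M),
      [/\ forall V, G V -> open V,
          forall m, exists2 V, G V & V m,
          forall V, G V -> exists2 U, F U & V `<=` U &
          forall m : M, exists2 W : set M, nbhs m W &
            finite_set [set V | G V /\ V `&` W !=set0]].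

Section Manifold.
Context (R : realType) (n : nat).

(* [ccoord] is only meaningful on [cdom], and [cparam], the inverse chart, only *)
(* on the image of [cdom]. *)
Record chart (M : topologicalType) := Chart {
  cdom : set M;
  ccoord : M -> 'rV[R]_n;
  cparam : 'rV[R]_n -> M;
  cdom_open : open cdom;
  cimg_open : open (ccoord @` cdom);
  ccoordK : forall m, cdom m -> cparam (ccoord m) = m;
  chart_continuous : forall m, cdom m -> {for m, continuous ccoord};
  chart_inv_continuous : forall x, (ccoord @` cdom) x -> {for x, continuous cparam} }.

Definition trans (M : topologicalType) (c c' : chart M) (x : 'rV[R]_n) :
  'rV[R]_n := ccoord c' (cparam c x).

Definition overlap (M : topologicalType) (c c' : chart M) : set 'rV[R]_n :=
  ccoord c @` (cdom c `&` cdom c').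

(* The atlas need not be maximal. *)
Record manifold := Manifold {
  carrier :> topologicalType;
  carrier_hausdorff : hausdorff_space carrier;
  carrier_paracompact : paracompact carrier;
  atlas : set (chart carrier);
  atlas_cover : forall m, exists2 c, atlas c & cdom c m;
  atlas_smooth : forall c c', atlas c -> atlas c' ->
    smooth_on (overlap c c') (trans c c') }.

End Manifold.

(* Coordinates (x, y) of a point of TM in the chart induced by a chart of M. *)
Notation TMcoord R n := ('rV[R]_n * 'rV[R]_n)%type.

Section TangentBundle.
Context (R : realType) (n : nat) (M : manifold R n).

(* Geometric objects on TM are given by their components in the induced charts *)
(* of TM, which are subject to the usual transformation laws. *)
Definition TMdom (c : chart R n M) : set (TMcoord R n) :=
  [set p | (ccoord c @` cdom c) p.1].

Definition TMtrans (c c' : chart R n M) (p : TMcoord R n) : TMcoord R n :=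
  (trans c c' p.1, 'D_(p.2) (trans c c') p.1).

Definition TMoverlap (c c' : chart R n M) : set (TMcoord R n) :=
  [set p | overlap c c' p.1].

(* [basis_vec mu] is the mu-th vector of the canonical basis of R^n. *)
Definition basis_vec (mu : 'I_n) : 'rV[R]_n := delta_mx 0 mu.

(* [jac c c' x b a] is the derivative of the a-th new coordinate with respect *)
(* to the b-th old one, so components of vectors transform by v' = v *m jac. *)
Definition jac (c c' : chart R n M) (x : 'rV[R]_n) : 'M[R]_n :=
  \matrix_(b, a) ('D_(basis_vec b) (trans c c') x) 0 a.

(* [dx mu], [dy a]: partial derivatives with respect to x^mu and y^a. *)
Definition dx (mu : 'I_n) (f : TMcoord R n -> R) (p : TMcoord R n) : R :=
  'D_(basis_vec mu, 0) f p.

Definition dy (a : 'I_n) (f : TMcoord R n -> R) (p : TMcoord R n) : R :=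
  'D_(0, basis_vec a) f p.

Definition x_only (c : chart R n M) (f : TMcoord R n -> R) : Prop :=
  exists f0 : 'rV[R]_n -> R, forall p, TMdom c p -> f p = f0 p.1.

(* [nlc c p a mu] is N^a_mu at p. The transformation law expresses that the *)
(* horizontal distribution spanned by the dx mu - N^a_mu dy a is globally *)
(* defined; its last term is the second derivative of the new a-th coordinate *)
(* with respect to x^nu and x^b, contracted with y^b. *)
Record nonlinear_connection := NonlinearConnection {
  nlc : chart R n M -> TMcoord R n -> 'M[R]_n;
  nlc_smooth : forall c, atlas c -> smooth_on (TMdom c) (nlc c);
  nlc_trans : forall c c', atlas c -> atlas c' ->
    forall p, TMoverlap c c' p -> forall a nu : 'I_n,
      \sum_mu nlc c' (TMtrans c c' p) a mu * jac c c' p.1 nu mu =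
      \sum_b jac c c' p.1 b a * nlc c p b nu -
        ('D_(basis_vec nu) ('D_(p.2) (trans c c')) p.1) 0 a }.

Definition delta (N : nonlinear_connection) (c : chart R n M) (mu : 'I_n)
    (f : TMcoord R n -> R) (p : TMcoord R n) : R :=
  dx mu f p - \sum_a nlc N c p a mu * dy a f p.

(* The i-th rows of [hframe c p] and [vframe c p] are the components of the *)
(* horizontal and vertical parts of lambda_i in the adapted frame. *)
Record EAP_space := EAPSpace {
  eap_nlc :> nonlinear_connection;
  hframe : chart R n M -> TMcoord R n -> 'M[R]_n;
  vframe : chart R n M -> TMcoord R n -> 'M[R]_n;
  hframe_smooth : forall c, atlas c -> smooth_on (TMdom c) (hframe c);
  vframe_smooth : forall c, atlas c -> smooth_on (TMdom c) (vframe c);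
  hframe_trans : forall c c', atlas c -> atlas c' ->
    forall p, TMoverlap c c' p ->
      hframe c' (TMtrans c c' p) = hframe c p *m jac c c' p.1;
  vframe_trans : forall c c', atlas c -> atlas c' ->
    forall p, TMoverlap c c' p ->
      vframe c' (TMtrans c c' p) = vframe c p *m jac c c' p.1;
  hframe_free : forall c, atlas c ->
    forall p, TMdom c p -> row_free (hframe c p);
  vframe_free : forall c, atlas c ->
    forall p, TMdom c p -> row_free (vframe c p) }.

(* Local coefficients of a d-connection, indices in the order in which they *)
(* are written: upper, first lower, second lower. *)
Record dcoefs := DCoefs {
  Gam_h : 'I_n -> 'I_n -> 'I_n -> TMcoord R n -> R;
  Gam_v : 'I_n -> 'I_n -> 'I_n -> TMcoord R n -> R;
  C_h : 'I_n -> 'I_n -> 'I_n -> TMcoord R n -> R;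
  C_v : 'I_n -> 'I_n -> 'I_n -> TMcoord R n -> R }.

(* The tensor P^a_{mu b} of a d-connection. *)
Definition P_tensor (N : nonlinear_connection) (c : chart R n M) (D : dcoefs)
    (a mu b : 'I_n) (p : TMcoord R n) : R :=
  dy b (fun q => nlc N c q a mu) p - Gam_v D a b mu p.

Definition Berwald_type (N : nonlinear_connection)
    (D : chart R n M -> dcoefs) : Prop :=
  forall c, atlas c -> forall p, TMdom c p ->
    (forall a b mu, dy b (fun q => nlc N c q a mu) p = Gam_v (D c) a b mu p) /\
    (forall al mu k, C_h (D c) al mu k p = 0).

(* The torsion component Lambda^al_{mu nu}. *)
Definition Lambda (D : dcoefs) (al mu nu : 'I_n) (p : TMcoord R n) : R :=
  Gam_h D al mu nu p - Gam_h D al nu mu p.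

Section EAP.
Context (E : EAP_space) (c : chart R n M).

(* lam_h i al = lambda_i^al and colam_h i al = lambda_{i al}, horizontal; *)
(* lam_v and colam_v are the vertical ones. *)
Definition lam_h (i al : 'I_n) (p : TMcoord R n) : R := hframe E c p i al.
Definition lam_v (i a : 'I_n) (p : TMcoord R n) : R := vframe E c p i a.
Definition colam_h (i al : 'I_n) (p : TMcoord R n) : R :=
  invmx (hframe E c p) al i.
Definition colam_v (i a : 'I_n) (p : TMcoord R n) : R :=
  invmx (vframe E c p) a i.

Definition g_h (al be : 'I_n) (p : TMcoord R n) : R :=
  \sum_i colam_h i al p * colam_h i be p.
Definition g_v (a b : 'I_n) (p : TMcoord R n) : R :=
  \sum_i colam_v i a p * colam_v i b p.
Definition ginv_h (al be : 'I_n) (p : TMcoord R n) : R :=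
  invmx (\matrix_(mu, nu) g_h mu nu p) al be.
Definition ginv_v (a b : 'I_n) (p : TMcoord R n) : R :=
  invmx (\matrix_(d, e) g_v d e p) a b.

Definition natural_dconn : dcoefs := {|
  Gam_h := fun al mu nu p => 2^-1 * \sum_ep ginv_h al ep p *
    (delta E c mu (g_h ep nu) p + delta E c nu (g_h ep mu) p
     - delta E c ep (g_h mu nu) p);
  Gam_v := fun a b nu p => dy b (fun q => nlc E c q a nu) p +
    2^-1 * \sum_k ginv_v a k p *
      (delta E c nu (g_v b k) p
       - \sum_d g_v d k p * dy b (fun q => nlc E c q d nu) p
       - \sum_d g_v b d p * dy k (fun q => nlc E c q d nu) p);
  C_h := fun al mu k p =>
    2^-1 * \sum_ep ginv_h al ep p * dy k (g_h mu ep) p;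
  C_v := fun a b k p => 2^-1 * \sum_d ginv_v a d p *
    (dy b (g_v d k) p + dy k (g_v d b) p - dy d (g_v b k) p) |}.

Definition canonical_dconn : dcoefs := {|
  Gam_h := fun al mu nu p =>
    \sum_i lam_h i al p * delta E c nu (colam_h i mu) p;
  Gam_v := fun a b nu p =>
    \sum_i lam_v i a p * delta E c nu (colam_v i b) p;
  C_h := fun al mu k p => \sum_i lam_h i al p * dy k (colam_h i mu) p;
  C_v := fun a b k p => \sum_i lam_v i a p * dy k (colam_v i b) p |}.

(* Contortion components gamma^al_{mu nu}, gamma^a_{b mu}, gamma^al_{mu k}. *)
Definition gam_hh (al mu nu : 'I_n) (p : TMcoord R n) : R :=
  Gam_h canonical_dconn al mu nu p - Gam_h natural_dconn al mu nu p.
Definition gam_vh (a b mu : 'I_n) (p : TMcoord R n) : R :=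
  Gam_v canonical_dconn a b mu p - Gam_v natural_dconn a b mu p.
Definition gam_hv (al mu k : 'I_n) (p : TMcoord R n) : R :=
  C_h canonical_dconn al mu k p - C_h natural_dconn al mu k p.

End EAP.
End TangentBundle.

(* Main.v *)
(* C^alpha_{mu c} = 0 says that the matrix (lambda_i^alpha) annihilates the    *)
(* vertical derivatives of (lambda_{i mu}); since it is invertible these all   *)
(* vanish, and as the fibres of TM are whole vector spaces the lambda_{i mu}   *)
(* depend on x only. Then delta_mu acts on them as partial_mu, which gives     *)
(* (b)-(e). For (f), the canonical connection is metric because it             *)
(* parallelizes the frame: delta_nu g_{bc} = g_{dc} Gamma^d_{b nu} + g_{bd}    *)
(* Gamma^d_{c nu}. With Gamma^d_{b nu} = dot-partial_b N^d_nu, the correction  *)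
(* term in the natural coefficient Gamma^a_{b nu} cancels.                     *)

Require Import Defs.
From mathcomp Require Import all_boot all_order all_algebra.
From mathcomp Require Import all_classical all_reals all_analysis.
Local Open Scope ring_scope.

Set Implicit Arguments.
Unset Strict Implicit.
Unset Printing Implicit Defensive.

Import GRing.Theory.
Import numFieldNormedType.Exports.

(** The canonical coefficients are the frame contracted with derivatives of the coframe, so
    inverting the frame pointwise ([invmx_solve]) recovers those derivatives from the coefficients.
    For vertical derivatives of the horizontal coframe, C = 0 makes them vanish, and moving along
    lines in the fibres ([dy0_x_only]) yields dependence on x alone ([colam_h_x_only]); (c)-(e)
    follow through [delta_x_only]. For horizontal derivatives of the vertical coframe, the same
    inversion gives metricity ([delta_g_v]), which under the Berwald condition kills the correction
    term in the natural coefficient: this is (f). Part (a) is the Berwald condition itself. *)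

Lemma derivable_bigsum (R : numFieldType) (V W : normedModType R) (I : Type)
    (r : seq I) (P : pred I) (F : I -> V -> W) (p v : V) :
  (forall i, P i -> derivable (F i) p v) ->
  derivable (fun q => \sum_(i <- r | P i) F i q) p v.
Proof.
move=> dF; rewrite -fct_sumE.
elim/big_ind: _ => [|f g df dg|]; [exact: derivable_cst | exact: derivableD | exact: dF].
Qed.

Lemma derivable_bigprod (R : numFieldType) (V : normedModType R) (I : Type)
    (r : seq I) (P : pred I) (F : I -> V -> R) (p v : V) :
  (forall i, P i -> derivable (F i) p v) ->
  derivable (fun q => \prod_(i <- r | P i) F i q) p v.
Proof.
move=> dF; elim: r => [|i r IH].
  by under eq_fun do rewrite big_nil; exact: derivable_cst.
under eq_fun do rewrite big_cons; case: ifP => // Pi.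
by apply: derivableM => //; exact: dF.
Qed.

Lemma derivable_det (R : numFieldType) (V : normedModType R) (n : nat)
    (A : V -> 'M[R]_n) (p v : V) :
  (forall i j, derivable (fun q => A q i j) p v) ->
  derivable (fun q => \det (A q)) p v.
Proof.
move=> dA; apply: derivable_bigsum => s _.
by apply: derivableM; [exact: derivable_cst | exact: derivable_bigprod].
Qed.

Lemma derivable_invmx (R : numFieldType) (V : normedModType R) (n : nat)
    (A : V -> 'M[R]_n) (p v : V) (i j : 'I_n) :
  (\forall q \near p, A q \in unitmx) ->
  (forall i j, derivable (fun q => A q i j) p v) ->
  derivable (fun q => invmx (A q) i j) p v.
Proof.
move=> uA dA; have Ap : \det (A p) != 0.
  by have := nbhs_singleton uA; rewrite unitmxE unitfE.
(* [invmx] returns its argument on singular matrices, so the adjugate formula is available only near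
   [p]. *)
apply: (near_eq_derivable (f := fun q => (\det (A q))^-1 * \adj (A q) i j)).
  by near=> q; rewrite /invmx ifT ?mxE//; near: q.
apply: derivableM; first by apply: derivableV => //; exact: derivable_det.
under eq_fun do rewrite mxE.
apply: derivableM; first exact: derivable_cst.
apply: derivable_det => k l.
by under eq_fun do rewrite !mxE; exact: dA.
Unshelve. all: by end_near.
Qed.

Lemma derive_line_cst (R : numFieldType) (V W : normedModType R) (f : V -> W)
    (p v : V) :
  (forall h, f (h *: v + p) = f p) -> 'D_v f p = 0.
Proof.
move=> fE; rewrite -(derive_cst (f p) p v) /derive.
set F := fun h => _; set G := fun h => _; suff -> : F = G by [].
by apply/funext => h; rewrite /F /G /= fE.
Qed.

(** Restricting [f] to the line gives a function of one real variable with zero derivative on all of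
    R. *)
Lemma derive0_line_cst (R : realType) (V : normedModType R) (f : V -> R)
    (p v : V) :
  (forall t, derivable f (t *: v + p) v) ->
  (forall t, 'D_v f (t *: v + p) = 0) ->
  forall t, f (t *: v + p) = f p.
Proof.
move=> df f0 t; pose g (s : R) := f (s *: v + p).
have dg (s : R) : is_derive s (1 : R) g 0.
  have E : (fun h => h^-1 *: ((g \o shift s) (h *: 1) - g s)) =
           (fun h => h^-1 *: ((f \o shift (s *: v + p)) (h *: v) - f (s *: v + p))).
    by apply/funext => h; rewrite /g /= addrA -scalerDl [h *: 1]mulr1.
  apply: DeriveDef; first by rewrite /derivable E; exact: df.
  by rewrite -(f0 s) /derive E.
have -> : f p = g 0 by rewrite /g scale0r add0r.
exact: (is_derive_0_is_cst t 0 dg).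
Qed.

(** The hypothesis reads w A = X for row vectors. It is used with A the frame, w the derivatives of
    the coframe and X the connection coefficients. *)
Lemma invmx_solve (R : comUnitRingType) (n : nat) (A : 'M[R]_n)
    (w X : 'I_n -> R) :
  A \in unitmx -> (forall a, \sum_i A i a * w i = X a) ->
  forall j, w j = \sum_a X a * invmx A a j.
Proof.
move=> uA wX j; pose W := \row_i w i.
have WA : W *m A = \row_a X a.
  apply/rowP => a; rewrite !mxE -wX.
  by apply: eq_bigr => i _; rewrite mxE mulrC.
have := congr1 (fun Y : 'rV_n => Y 0 j) (mulmxK uA W).
rewrite WA !mxE => <-.
by apply: eq_bigr => a _; rewrite mxE.
Qed.

Lemma smooth_on_derivable (R : realType) (V : normedModType R) (D : set V)
    (m k : nat) (A : V -> 'M[R]_(m, k)) (p v : V)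
    (i : 'I_m) (j : 'I_k) :
  smooth_on D A -> D p -> derivable (fun q => A q i j) p v.
Proof.
move=> /(_ 1) [_ /(_ v) [dA _]] Dp.
by have /derivable_mxP := dA p Dp.
Qed.

(** * Functions of x only on an induced chart *)

Section EAPSpace.
Context (R : realType) (n : nat) (M : manifold R n).
Implicit Types (c : chart R n M) (f : TMcoord R n -> R) (p q : TMcoord R n).

Lemma open_TMdom c : open (TMdom c).
Proof.
apply: (@open_comp _ _ fst) => [p _|]; last exact: cimg_open.
exact: cvg_fst.
Qed.

Lemma x_onlyP c f :
  x_only c f <-> (forall p q, TMdom c p -> p.1 = q.1 -> f p = f q).
Proof.
split=> [[f0 f0E] p q Dp pq | fE].
  by rewrite !f0E ?pq // /TMdom /= -pq.
(* The witness is the restriction of [f] to the zero section. *)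
by exists (fun x => f (x, 0)) => p Dp; exact: fE.
Qed.

Lemma TMdom_fst c p q : TMdom c p -> p.1 = q.1 -> TMdom c q.
Proof. by rewrite /TMdom /= => ? <-. Qed.

Lemma dy_x_only c f k p : x_only c f -> TMdom c p -> dy k f p = 0.
Proof.
move=> /x_onlyP fE Dp; apply: derive_line_cst => h.
by apply/esym/fE => //=; rewrite scaler0 add0r.
Qed.

Lemma dx_x_only c f mu : x_only c f -> x_only c (dx mu f).
Proof.
case=> f0 f0E; exists (fun x => 'D_(basis_vec R mu) f0 x) => p Dp.
(* Near [p] the function is [f0 \o fst], whose difference quotients along (e_mu, 0) are those of
   [f0] along e_mu; no differentiability is involved. *)
rewrite /dx (near_eq_derive (g := f0 \o fst)) //.
by apply: filterS (open_nbhs_nbhs (conj (open_TMdom (c := c)) Dp)) => q /f0E.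
Qed.

Lemma delta_x_only (N : nonlinear_connection M) c f mu p :
  x_only c f -> TMdom c p -> delta N c mu f p = dx mu f p.
Proof.
move=> fx Dp; rewrite /delta big1 ?subr0 // => a _.
by rewrite (dy_x_only _ fx) ?mulr0.
Qed.

Lemma dy0_x_only c f :
  (forall p, TMdom c p -> forall v, derivable f p v) ->
  (forall k p, TMdom c p -> dy k f p = 0) -> x_only c f.
Proof.
move=> df f0; exists (fun x => f (x, 0)) => -[x y] Dp /=.
(* The components of y are removed one at a time; each move is along a vertical coordinate line,
   which stays in the domain because the fibre is the whole vector space. *)
rewrite [y]row_sum_delta; elim/big_rec: _ => // k z _ <-.
have -> : (x, y 0 k *: delta_mx 0 k + z) =
          y 0 k *: ((0, basis_vec R k) : TMcoord R n) + (x, z).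
  by congr pair; rewrite /= ?scaler0 ?add0r.
apply: derive0_line_cst => t; [apply: df | apply: f0].
  by apply: TMdom_fst Dp _; rewrite /= scaler0 add0r.
by apply: TMdom_fst Dp _; rewrite /= scaler0 add0r.
Qed.

(** Leibniz rule: [delta] is a first-order differential operator. *)
Lemma delta_sumM (N : nonlinear_connection M) c mu p
    (f h : 'I_n -> TMcoord R n -> R) :
  (forall i v, derivable (f i) p v) -> (forall i v, derivable (h i) p v) ->
  delta N c mu (fun q => \sum_i f i q * h i q) p =
  \sum_i (delta N c mu (f i) p * h i p + f i p * delta N c mu (h i) p).
Proof.
move=> df dh; have DE v : 'D_v (fun q => \sum_i f i q * h i q) p =
    \sum_i (f i p * 'D_v (h i) p + h i p * 'D_v (f i) p).
  rewrite -fct_sumE derive_sum => [|i]; last exact: derivableM.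
  by apply: eq_bigr => i _; rewrite (deriveM (df i v) (dh i v)).
rewrite /delta /dx /dy !DE.
under [X in _ - X]eq_bigr do rewrite DE mulr_sumr.
rewrite exchange_big /= -sumrB; apply: eq_bigr => i _.
rewrite mulrBl mulrBr addrACA -opprD [X in X - _]addrC.
congr (_ + _ - _); first by rewrite mulrC.
rewrite [RHS]addrC.
rewrite mulr_suml mulr_sumr -big_split /=; apply: eq_bigr => a _.
by rewrite mulrDr; congr (_ + _); [rewrite mulrCA | rewrite mulrAC mulrA].
Qed.

(** * Derivatives of the coframe from the canonical coefficients *)

Context (E : EAP_space M) (c : chart R n M) (Ac : atlas c).

Lemma hframe_unit p : TMdom c p -> hframe E c p \in unitmx.
Proof. by move=> Dp; rewrite -row_free_unit; exact: hframe_free. Qed.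

Lemma vframe_unit p : TMdom c p -> vframe E c p \in unitmx.
Proof. by move=> Dp; rewrite -row_free_unit; exact: vframe_free. Qed.

Lemma derivable_colam_h i mu p v :
  TMdom c p -> derivable (colam_h E c i mu) p v.
Proof.
move=> Dp; apply: derivable_invmx => [|k l].
  apply: filterS (open_nbhs_nbhs (conj (open_TMdom (c := c)) Dp)).
  exact: hframe_unit.
exact: smooth_on_derivable (hframe_smooth E Ac) Dp.
Qed.

Lemma derivable_colam_v i a p v :
  TMdom c p -> derivable (colam_v E c i a) p v.
Proof.
move=> Dp; apply: derivable_invmx => [|k l].
  apply: filterS (open_nbhs_nbhs (conj (open_TMdom (c := c)) Dp)).
  exact: vframe_unit.
exact: smooth_on_derivable (vframe_smooth E Ac) Dp.
Qed.

(* The canonical d-connection parallelizes the frame, hence is metric. *)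
Lemma delta_g_v nu b k p : TMdom c p ->
  delta E c nu (g_v E c b k) p =
  \sum_d g_v E c d k p * Gam_v (canonical_dconn E c) d b nu p +
  \sum_d g_v E c b d p * Gam_v (canonical_dconn E c) d k nu p.
Proof.
(* Parallelism of the coframe, solved for its derivative: delta_nu lambda_{je} = Gamma^a_{e nu}
   lambda_{ja}. *)
move=> Dp; have lamE e j : delta E c nu (colam_v E c j e) p =
    \sum_a Gam_v (canonical_dconn E c) a e nu p * colam_v E c j a p.
  exact: (invmx_solve (vframe_unit Dp) (w := fun i => delta E c nu (colam_v E c i e) p)).
rewrite [LHS]delta_sumM; try by move=> i v; exact: derivable_colam_v.
rewrite big_split /=; congr (_ + _).
  under eq_bigr do rewrite lamE mulr_suml.
  rewrite exchange_big /=; apply: eq_bigr => d _.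
  by rewrite mulr_suml; apply: eq_bigr => i _; rewrite -mulrA mulrC.
under eq_bigr do rewrite lamE mulr_sumr.
rewrite exchange_big /=; apply: eq_bigr => d _.
by rewrite mulr_suml; apply: eq_bigr => i _; rewrite mulrCA mulrC.
Qed.

Lemma colam_h_x_only i mu :
  (forall al k p, TMdom c p -> C_h (canonical_dconn E c) al mu k p = 0) ->
  x_only c (colam_h E c i mu).
Proof.
move=> C0; apply: dy0_x_only => [p Dp v|k p Dp]; first exact: derivable_colam_h.
have wE al := C0 al k p Dp.
rewrite (invmx_solve (hframe_unit Dp)
  (w := fun i => dy k (colam_h E c i mu) p) wE) big1 // => a _.
by rewrite mul0r.
Qed.

(** * Consequences of the horizontal coframe depending on x only *)

Hypothesis colam_x : forall i mu, x_only c (colam_h E c i mu).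

Lemma lam_h_x_only i al : x_only c (lam_h E c i al).
Proof.
(* The frame is the inverse of the coframe, whose entries agree at [p] and [q]. *)
apply/x_onlyP => p q Dp pq; rewrite /lam_h -[hframe E c p]invmxK.
rewrite -[hframe E c q]invmxK; congr (invmx _ i al); apply/matrixP => mu j.
by have /x_onlyP := colam_x j mu; exact.
Qed.

Lemma g_h_x_only mu nu : x_only c (g_h E c mu nu).
Proof.
apply/x_onlyP => p q Dp pq; apply: eq_bigr => i _.
by congr (_ * _); move: p q Dp pq; exact/x_onlyP.
Qed.

Lemma ginv_h_x_only mu nu : x_only c (ginv_h E c mu nu).
Proof.
apply/x_onlyP => p q Dp pq; congr (invmx _ mu nu); apply/matrixP => a b.
by rewrite !mxE; move: p q Dp pq; exact/x_onlyP/g_h_x_only.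
Qed.

Lemma canonical_Gam_hE al mu nu p : TMdom c p ->
  Gam_h (canonical_dconn E c) al mu nu p =
  \sum_i lam_h E c i al p * dx nu (colam_h E c i mu) p.
Proof.
by move=> Dp; apply: eq_bigr => i _; rewrite (delta_x_only _ _ (colam_x i mu)).
Qed.

Lemma natural_Gam_hE al mu nu p : TMdom c p ->
  Gam_h (natural_dconn E c) al mu nu p =
  2^-1 * \sum_ep ginv_h E c al ep p *
    (dx mu (g_h E c nu ep) p + dx nu (g_h E c mu ep) p
     - dx ep (g_h E c mu nu) p).
Proof.
move=> Dp; congr (_ * _); apply: eq_bigr => ep _.
have gC a b : g_h E c a b = g_h E c b a.
  by apply/funext => q; apply: eq_bigr => i _; rewrite mulrC.
by rewrite !(delta_x_only _ _ (g_h_x_only _ _)) // (gC ep nu) (gC ep mu).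
Qed.

Lemma canonical_Gam_h_x_only al mu nu :
  x_only c (Gam_h (canonical_dconn E c) al mu nu).
Proof.
apply/x_onlyP => p q Dp pq.
rewrite !canonical_Gam_hE //; last exact: TMdom_fst pq.
apply: eq_bigr => i _; congr (_ * _); move: p q Dp pq; apply/x_onlyP.
  exact: lam_h_x_only.
exact/dx_x_only.
Qed.

Lemma natural_Gam_h_x_only al mu nu :
  x_only c (Gam_h (natural_dconn E c) al mu nu).
Proof.
have dg a b e : x_only c (dx e (g_h E c a b)) by exact/dx_x_only/g_h_x_only.
apply/x_onlyP => p q Dp pq.
rewrite !natural_Gam_hE //; last exact: TMdom_fst pq.
congr (_ * _); apply: eq_bigr => ep _.
congr (_ * (_ + _ - _)); move: p q Dp pq; apply/x_onlyP => //.
exact: ginv_h_x_only.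
Qed.

Lemma natural_C_h0 al mu k p : TMdom c p ->
  C_h (natural_dconn E c) al mu k p = 0.
Proof.
move=> Dp; rewrite /= big1 ?mulr0 // => ep _.
by rewrite (dy_x_only _ (g_h_x_only mu ep)) ?mulr0.
Qed.

End EAPSpace.

Theorem theorem6p3 (R : realType) (n : nat) (M : manifold R n)
    (E : EAP_space M) (hB : Berwald_type E (canonical_dconn E)) :
  forall c : chart R n M, atlas c ->
  (* (a) *)
  (forall a mu b p, TMdom c p -> P_tensor E c (canonical_dconn E c) a mu b p = 0)
  /\
  (* (b) *)
  ((forall i mu, x_only c (colam_h E c i mu)) /\
   (forall mu nu, x_only c (g_h E c mu nu)))
  /\
  (* (c) *)
  ((forall al mu k p, TMdom c p -> C_h (natural_dconn E c) al mu k p = 0) /\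
   (forall al mu k p, TMdom c p -> gam_hv E c al mu k p = 0))
  /\
  (* (d) *)
  ((forall al mu nu, x_only c (Gam_h (canonical_dconn E c) al mu nu)) /\
   (forall al mu nu, x_only c (Gam_h (natural_dconn E c) al mu nu)) /\
   (forall al mu nu p, TMdom c p ->
      Gam_h (canonical_dconn E c) al mu nu p =
      \sum_i lam_h E c i al p * dx nu (colam_h E c i mu) p) /\
   (forall al mu nu p, TMdom c p ->
      Gam_h (natural_dconn E c) al mu nu p =
      2^-1 * \sum_ep ginv_h E c al ep p *
        (dx mu (g_h E c nu ep) p + dx nu (g_h E c mu ep) p
         - dx ep (g_h E c mu nu) p)))
  /\
  (* (e) *)
  ((forall al mu nu, x_only c (Lambda (canonical_dconn E c) al mu nu)) /\
   (forall al mu nu, x_only c (gam_hh E c al mu nu)))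
  /\
  (* (f) *)
  ((forall a b mu p, TMdom c p -> gam_vh E c a b mu p = 0) /\
   (forall a mu b p, TMdom c p -> P_tensor E c (natural_dconn E c) a mu b p = 0) /\
   (forall a b mu p, TMdom c p ->
      Gam_v (canonical_dconn E c) a b mu p = Gam_v (natural_dconn E c) a b mu p)).
Proof.
move=> c Ac.
have NE a b mu p : TMdom c p ->
    dy b (fun q => nlc E c q a mu) p = Gam_v (canonical_dconn E c) a b mu p.
  by move=> Dp; have [] := hB c Ac p Dp.
have C0 al mu k p : TMdom c p -> C_h (canonical_dconn E c) al mu k p = 0.
  by move=> Dp; have [] := hB c Ac p Dp.
have colam_x i mu : x_only c (colam_h E c i mu).
  by apply: colam_h_x_only => // *; exact: C0.
have GE a b mu p : TMdom c p ->
    Gam_v (canonical_dconn E c) a b mu p = Gam_v (natural_dconn E c) a b mu p.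
  move=> Dp; rewrite [RHS]/= NE // big1 ?mulr0 ?addr0 // => k _.
  (* Metricity expands delta_nu g_{bk} into the two sums being subtracted, once the vertical
     derivatives of N are replaced by the canonical coefficients. *)
  rewrite delta_g_v //; under [X in _ - X - _]eq_bigr do rewrite NE //.
  under [X in _ - X]eq_bigr do rewrite NE //.
  by rewrite addrAC -addrA -opprD [X in X - _]addrC subrr mulr0.
split=> [a mu b p Dp|]; first by rewrite /P_tensor NE ?subrr.
split; first by split=> // mu nu; exact: g_h_x_only.
split.
  split=> al mu k p Dp; first exact: natural_C_h0.
  by rewrite /gam_hv C0 // natural_C_h0 // subrr.
split.
  split; first exact: canonical_Gam_h_x_only.
  split; first exact: natural_Gam_h_x_only.
  by split=> *; [exact: canonical_Gam_hE | exact: natural_Gam_hE].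
split.
  split=> al mu nu; apply/x_onlyP => p q Dp pq; congr (_ - _);
    move: p q Dp pq; apply/x_onlyP; try exact: canonical_Gam_h_x_only.
  exact: natural_Gam_h_x_only.
(* Both vanishing statements are read off from the equality [GE] of the two coefficients. *)
split; first by move=> *; rewrite /gam_vh GE ?subrr.
by split=> // a mu b p Dp; rewrite /P_tensor -GE // NE ?subrr.
Qed.
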